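(* Let $\phi \in \mathcal{S}(\mathcal{G}_\delta)$, let $T \in \mathcal{B}_\delta$ with $T \in \mathbb{M}_n^d$, and suppose that $$\liminf_{\mathcal{G}_\delta \ni Z \to T} \frac{\| I - \phi(Z)^* \phi(Z) \|}{1 - \| \delta(Z) \|^2} = \alpha < \infty .$$ Then there exists an $n\times n$ unitary matrix $W$ such that for all $Z \in \mathcal{G}_\delta \cap \mathbb{M}_n^d$ $$\frac{\| \phi(Z) - W \|^2}{\| I - \phi(Z)^* \phi(Z) \|} \ \leq \ \alpha \left( \frac{\| I - \delta(T)^* \delta(Z) \|^2}{1 - \| \delta(Z)\|^2 }\right).$$
   Context: $\mathbb{M}_n$ is the set of $n\times n$ complex matrices and $\mathbb{M}^{[d]} = \bigcup_{n\ge 1} \mathbb{M}_n^d$. $\delta$ is a $J\times J$ matrix whose entries are non-commutative polynomials in $d$ variables; for $x\in\mathbb{M}_n^d$, $\delta(x)$ is an operator on $\mathbb{C}^J\otimes\mathbb{C}^n$ with the operator norm. $\mathcal{G}_\delta = \bigcup_{n\ge1}\{x\in\mathbb{M}_n^d : \|\delta(x)\|<1\}$, and $\mathcal{B}_\delta$ is the topological boundary of $\mathcal{G}_\delta$ (taken in each $\mathbb{M}_n^d$). An nc-function on $\Omega\subseteq\mathbb{M}^{[d]}$ is a function $\phi$ that is graded ($x\in\mathbb{M}_n^d$ implies $\phi(x)\in\mathbb{M}_n$) and satisfies $\phi(x\oplus y)=\phi(x)\oplus\phi(y)$ and $\phi(s^{-1}xs)=s^{-1}\phi(x)s$ (for $s\in\mathbb{M}_n$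 invertible, acting componentwise on $x\in\mathbb{M}_n^d$) whenever the arguments on both sides lie in $\Omega$. The Schur class $\mathcal{S}(\mathcal{G}_\delta)$ is the set of nc-functions $\phi$ on $\mathcal{G}_\delta$ with $\|\phi(x)\|<1$ for all $x\in\mathcal{G}_\delta$. In the $\liminf$, $Z$ ranges over $\mathcal{G}_\delta\cap\mathbb{M}_n^d$. *)

(* Defs.v *)
From HB Require Import structures.
From mathcomp Require Import all_boot all_order all_algebra.
From mathcomp Require Import finmap complex mxtens.
From mathcomp Require Import boolp classical_sets reals ereal topology normedtype.
(* The notations of monalg have levels incompatible with those of the topology
   files; only its definitions and canonical structures are imported. *)
From mathcomp Require Import -(notations) monalg.

Set Implicit Arguments.
Unset Strict Implicit.
Unset Printing Implicit Defensive.

Import Order.TTheory GRing.Theory Num.Theory.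
Import numFieldNormedType.Exports.

Local Open Scope classical_set_scope.
Local Open Scope complex_scope.
Local Open Scope ring_scope.
Local Open Scope sesquilinear_scope.

(* The usual topology of the complex numbers; matrices over R[i], and tuples of
   such matrices, then carry the entrywise (product) topology. *)
HB.instance Definition _ (R : realType) := NormedModule.copy R[i] R[i]^o.

Section OperatorNorm.
Variable R : realType.

Definition l2norm m (v : 'cV[R[i]]_m) : R :=
  Num.sqrt (\sum_(i < m) Normc.normc (v i 0) ^+ 2).

Definition opnorm m n (A : 'M[R[i]]_(m, n)) : R :=
  sup [set l2norm (A *m v) | v in [set v : 'cV[R[i]]_n | l2norm v <= 1]].

End OperatorNorm.

Definition frontier (T : topologicalType) (A : set T) : set T :=
  closure A `\` interior A.

Section NonCommutative.
Variables (R : realType) (d : nat).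

(* d-tuples of n x n complex matrices; the r-th component of x is x 0 r. *)
Definition mtuple (n : nat) := 'rV['M[R[i]]_n]_d.

(* The free associative algebra on d generators: finitely supported functions
   from words over 'I_d to R[i]. *)
Definition ncpoly := malg (fmonom 'I_d) R[i].

Definition nceval (p : ncpoly) n (x : mtuple n) : 'M[R[i]]_n :=
  \sum_(w <- msupp p) mcoeff w p *: \prod_(r <- fmonom_val w) x 0 r.

(* The operator on C^J (x) C^n, i.e. the J x J block matrix whose (i, j) block
   is the value at x of the (i, j) entry of delta. *)
Definition mxeval J (delta : 'M[ncpoly]_J) n (x : mtuple n) :
    'M[R[i]]_(J * n) :=
  \sum_(i < J) \sum_(j < J) tensmx (delta_mx i j) (nceval (delta i j) x).

(* A graded subset of the disjoint union of the M_n^d. Level n = 0 is not part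
   of M^[d]; it is left out of the sets that are considered. *)
Definition ncset := forall n, set (mtuple n).

Definition polyhedron J (delta : 'M[ncpoly]_J) : ncset :=
  fun n => [set x | (0 < n)%N /\ opnorm (mxeval delta x) < 1].

Definition polyhedron_boundary J (delta : 'M[ncpoly]_J) : ncset :=
  fun n => frontier (polyhedron delta (n := n)).

Definition dsum n m (x : mtuple n) (y : mtuple m) : mtuple (n + m) :=
  \row_(r < d) block_mx (x 0 r) 0 0 (y 0 r).

Definition similar n (s : 'M[R[i]]_n) (x : mtuple n) : mtuple n :=
  \row_(r < d) (invmx s *m x 0 r *m s).

(* Graded functions are total here; their values outside the domain Omega of
   interest are never constrained nor used. *)
Definition graded_fun := forall n, mtuple n -> 'M[R[i]]_n.

Definition nc_function (Omega : ncset) (phi : graded_fun) : Prop :=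
  (forall n m (x : mtuple n) (y : mtuple m),
     Omega n x -> Omega m y -> Omega (n + m)%N (dsum x y) ->
     phi (n + m)%N (dsum x y) = block_mx (phi n x) 0 0 (phi m y)) /\
  (forall n (s : 'M[R[i]]_n) (x : mtuple n),
     s \in unitmx -> Omega n x -> Omega n (similar s x) ->
     phi n (similar s x) = invmx s *m phi n x *m s).

Definition schur_class J (delta : 'M[ncpoly]_J) (phi : graded_fun) : Prop :=
  nc_function (polyhedron delta) phi /\
  (forall n (x : mtuple n), polyhedron delta x -> opnorm (phi n x) < 1).

End NonCommutative.

(* Main.v *)
Require Import Defs.
From mathcomp Require Import all_boot all_order all_algebra.
From mathcomp Require Import complex.
From mathcomp Require Import -(notations) mxtens.
From mathcomp Require Import ring lra.
From mathcomp Require Import boolp classical_sets reals ereal topology normedtype.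
From mathcomp Require Import -(notations) monalg.
Import Order.TTheory GRing.Theory Num.Theory.
Import numFieldNormedType.Exports.
Local Open Scope classical_set_scope.
Local Open Scope complex_scope.
Local Open Scope ring_scope.
Local Open Scope sesquilinear_scope.

(** Writing [defect A B] for [1 - A^* B] and r(Z) for the quotient
    |defect (phi Z) (phi Z)| / (1 - |delta Z|^2), everything follows from the
    two-point Schwarz-Pick inequality [schur_two_point]: for Y and Z in the
    polyhedron,

      |defect (phi Y) (phi Z)|^2 <= r(Y) r(Z) |defect (delta Y) (delta Z)|^2.

    Let Y tend to T along points where r(Y) tends to alpha. The matrices phi Y
    stay in the unit ball, hence have a cluster point W. As 1 - |delta Y|^2
    tends to a number that is at most 0 while r(Y) stays bounded,
    defect (phi Y) (phi Y) tends to 0, so W is unitary. The inequality passes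
    to the limit, and |phi Z - W| = |1 - W^* phi Z| because W is unitary.

    The two-point inequality could be read off a Hilbert space model of phi,
    but it also has a direct proof from one well chosen point of level 2n.
    For b > 1 put S = [[1, -1], [0, sqrt (b - 1)]] and X = S (Y + Z) S^-1, where
    Y + Z is the direct sum. The block columns F1 and F2 of S satisfy
    X F1 = F1 Y and X F2 = F2 Z, and, S being scalar in each block,

      |F1 v1 + F2 v2|^2 = |v1|^2 - 2 Re <v1, v2> + b |v2|^2.

    Both delta and phi respect these intertwining relations: delta because its
    entries are polynomials, phi because it is an nc-function. Therefore
    delta X, in the coordinates (v1, v2), is just (delta Y, delta Z), and
    comparing quadratic forms shows that it is a strict contraction as soon as
    |defect (delta Y) (delta Z)|^2 < (1 - |delta Y|^2) b (1 - |delta Z|^2)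
    ([opnorm_gram_lt1]). Then X lies in the polyhedron, so phi X is a
    contraction, and the same comparison read backwards gives
    |defect (phi Y) (phi Z)|^2
      <= |defect (phi Y) (phi Y)| b |defect (phi Z) (phi Z)|
    ([opnorm_defect_cross]). Letting b decrease to its least admissible value
    yields the claim; that value is at least 1 by [defect_ratio_ge1]. *)

(** * The Hilbert space operator norm *)

Section OperatorNormTheory.
Set Implicit Arguments.
Unset Strict Implicit.
Context {R : realType}.

(** The real part of the inner product: real bilinear and symmetric, which is all
    that the quadratic forms below need. *)
Definition rdot m (v w : 'cV[R[i]]_m) : R := complex.Re ((v^t* *m w) 0 0).

Lemma rdotE m (v w : 'cV[R[i]]_m) :
  rdot v w = \sum_i (complex.Re (v i 0) * complex.Re (w i 0)
                     + complex.Im (v i 0) * complex.Im (w i 0)).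
Proof.
rewrite /rdot mxE (raddf_sum (@complex.Re R : Rcomplex R -> R)).
apply: eq_bigr => i _.
rewrite !mxE; case: (v i 0) => a b; case: (w i 0) => c e /=; ring.
Qed.

Lemma rdotC m (v w : 'cV[R[i]]_m) : rdot v w = rdot w v.
Proof.
by rewrite !rdotE; apply: eq_bigr => i _; congr (_ + _); exact: mulrC.
Qed.

Lemma rdotDr m (u v w : 'cV[R[i]]_m) : rdot u (v + w) = rdot u v + rdot u w.
Proof. by rewrite /rdot mulmxDr mxE; case: (_ 0 0); case: (_ 0 0). Qed.

Lemma rdotDl m (u v w : 'cV[R[i]]_m) : rdot (v + w) u = rdot v u + rdot w u.
Proof. by rewrite !(rdotC _ u) rdotDr. Qed.

Lemma rdotZr m (a : R) (v w : 'cV[R[i]]_m) : rdot v (a%:C *: w) = a * rdot v w.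
Proof.
rewrite /rdot -scalemxAr mxE; case: (_ 0 0) => x y /=; ring.
Qed.

Lemma rdotZl m (a : R) (v w : 'cV[R[i]]_m) : rdot (a%:C *: v) w = a * rdot v w.
Proof. by rewrite rdotC rdotZr rdotC. Qed.

Lemma rdotNr m (v w : 'cV[R[i]]_m) : rdot v (- w) = - rdot v w.
Proof. by rewrite /rdot mulmxN mxE; case: (_ 0 0). Qed.

Lemma rdotNl m (v w : 'cV[R[i]]_m) : rdot (- v) w = - rdot v w.
Proof. by rewrite rdotC rdotNr rdotC. Qed.

Lemma rdotBr m (u v w : 'cV[R[i]]_m) : rdot u (v - w) = rdot u v - rdot u w.
Proof. by rewrite rdotDr rdotNr. Qed.

Lemma rdot_adj m k (A : 'M[R[i]]_(m, k)) v w :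
  rdot (A *m v) w = rdot v (A^t* *m w).
Proof. by rewrite /rdot trmx_mul map_mxM mulmxA. Qed.

Lemma sqr_normc (z : R[i]) :
  Normc.normc z ^+ 2 = complex.Re z ^+ 2 + complex.Im z ^+ 2.
Proof. by case: z => a b /=; rewrite sqr_sqrtr ?addr_ge0 ?sqr_ge0. Qed.

Lemma normc_ge0 (z : R[i]) : 0 <= Normc.normc z.
Proof. by case: z => a b; exact: sqrtr_ge0. Qed.

Lemma l2norm_ge0 m (v : 'cV[R[i]]_m) : 0 <= l2norm v.
Proof. exact: sqrtr_ge0. Qed.

Lemma sqr_l2norm m (v : 'cV[R[i]]_m) : l2norm v ^+ 2 = rdot v v.
Proof.
rewrite sqr_sqrtr; last by apply: sumr_ge0 => i _; exact: sqr_ge0.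
by rewrite rdotE; apply: eq_bigr => i _; rewrite sqr_normc !expr2.
Qed.

Lemma rdot_ge0 m (v : 'cV[R[i]]_m) : 0 <= rdot v v.
Proof. by rewrite -sqr_l2norm sqr_ge0. Qed.

Lemma l2norm0 m : l2norm (0 : 'cV[R[i]]_m) = 0.
Proof.
apply/eqP; rewrite -sqrf_eq0 sqr_l2norm rdotE big1// => i _.
by rewrite mxE/= mulr0 addr0.
Qed.

Lemma l2norm0_eq0 m (v : 'cV[R[i]]_m) : l2norm v = 0 -> v = 0.
Proof.
move=> v0; apply/matrixP => i j; rewrite ord1 mxE.
have : \sum_i Normc.normc (v i 0) ^+ 2 == 0.
  move/eqP: v0; rewrite sqrtr_eq0 => h; rewrite eq_le h /=.
  by apply: sumr_ge0 => k _; exact: sqr_ge0.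
rewrite psumr_eq0; last by move=> k _; exact: sqr_ge0.
move/allP => /(_ i); rewrite mem_index_enum sqrf_eq0 => /(_ isT) /eqP.
exact: Normc.eq0_normc.
Qed.

(** The Cauchy-Schwarz inequality. *)
Lemma rdot_le m (v w : 'cV[R[i]]_m) : rdot v w <= l2norm v * l2norm w.
Proof.
have [v0|v0] := eqVneq (l2norm v) 0.
  by rewrite v0 (l2norm0_eq0 v0) mul0r /rdot trmx0 map_mx0 mul0mx mxE.
have [w0|w0] := eqVneq (l2norm w) 0.
  by rewrite w0 (l2norm0_eq0 w0) mulr0 /rdot mulmx0 mxE.
have vp : 0 < l2norm v by rewrite lt0r v0 l2norm_ge0.
have wp : 0 < l2norm w by rewrite lt0r w0 l2norm_ge0.
(* The square of the norm of |w| v - |v| w is 2 |v| |w| (|v| |w| - <v, w>). *)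
have := rdot_ge0 ((l2norm w)%:C *: v + (- l2norm v)%:C *: w).
rewrite !(rdotDl, rdotDr, rdotZl, rdotZr) (rdotC w v) -!sqr_l2norm.
rewrite [leRHS](_ : _ =
  (2 * (l2norm v * l2norm w)) * (l2norm v * l2norm w - rdot v w)); last by ring.
by rewrite pmulr_rge0 ?subr_ge0// !mulr_gt0.
Qed.

Lemma l2normD m (v w : 'cV[R[i]]_m) : l2norm (v + w) <= l2norm v + l2norm w.
Proof.
rewrite -(@ler_pXn2r _ 2) ?nnegrE ?addr_ge0 ?l2norm_ge0// sqr_l2norm.
rewrite !(rdotDl, rdotDr) (rdotC w v) sqrrD -!sqr_l2norm mulr2n.
have := rdot_le v w; lra.
Qed.

Lemma l2normZ m (a : R[i]) (v : 'cV[R[i]]_m) :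
  l2norm (a *: v) = Normc.normc a * l2norm v.
Proof.
apply/eqP; rewrite -(@eqrXn2 _ 2) ?mulr_ge0 ?l2norm_ge0 ?normc_ge0//.
rewrite exprMn !sqr_l2norm !rdotE mulr_sumr; apply/eqP/eq_bigr => i _.
rewrite sqr_normc mxE; case: a => x y; case: (v i 0) => c e /=; ring.
Qed.

Lemma l2normN m (v : 'cV[R[i]]_m) : l2norm (- v) = l2norm v.
Proof.
have n1 : Normc.normc (-1 : R[i]) = 1.
  by rewrite /= oppr0 sqrrN expr1n expr0n addr0 sqrtr1.
by rewrite -scaleN1r l2normZ n1 mul1r.
Qed.

Lemma l2norm_sum m I (r : seq I) (F : I -> 'cV[R[i]]_m) :
  l2norm (\sum_(i <- r) F i) <= \sum_(i <- r) l2norm (F i).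
Proof.
elim/big_ind2: _ => [|x a y b xa yb|//]; first by rewrite l2norm0.
by apply: (le_trans (l2normD _ _)); exact: lerD.
Qed.

Lemma normc_le_l2norm m (v : 'cV[R[i]]_m) i : Normc.normc (v i 0) <= l2norm v.
Proof.
rewrite -(@ler_pXn2r _ 2) ?nnegrE ?l2norm_ge0 ?normc_ge0// sqr_l2norm.
rewrite rdotE (bigD1 i)//= sqr_normc !expr2 lerDl; apply: sumr_ge0 => j _.
by rewrite addr_ge0// -expr2 sqr_ge0.
Qed.

Lemma l2norm_delta m (i : 'I_m) : l2norm (delta_mx i 0 : 'cV[R[i]]_m) = 1.
Proof.
apply/eqP; rewrite -(@eqrXn2 _ 2) ?l2norm_ge0// expr1n sqr_l2norm rdotE.
rewrite (bigD1 i)//= big1 ?mxE ?eqxx/= ?mul0r ?mulr1 ?addr0//.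
by move=> j ji; rewrite mxE (negbTE ji)/= mul0r addr0.
Qed.

(** The crude bound by the sum of the entries makes the supremum defining the
    operator norm a genuine one, and later turns entrywise convergence into
    convergence in norm. *)
Lemma l2norm_mul_entries m n (A : 'M[R[i]]_(m, n)) v :
  l2norm (A *m v) <= (\sum_i \sum_j Normc.normc (A i j)) * l2norm v.
Proof.
have -> : A *m v = \sum_i \sum_j (A i j * v j 0) *: delta_mx i 0.
  apply/matrixP => i j; rewrite ord1 mxE summxE (bigD1 i)//= summxE.
  rewrite [X in _ + X]big1 ?addr0.
    by apply: eq_bigr => k _; rewrite !mxE !eqxx mulr1.
  move=> k ki; rewrite summxE big1// => l _.
  by rewrite !mxE eq_sym (negbTE ki) mulr0.
rewrite mulr_suml; apply: (le_trans (l2norm_sum _ _)); apply: ler_sum => i _.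
rewrite mulr_suml; apply: (le_trans (l2norm_sum _ _)); apply: ler_sum => j _.
rewrite l2normZ Normc.normcM l2norm_delta mulr1.
by rewrite ler_wpM2l ?normc_ge0 ?normc_le_l2norm.
Qed.

Let unit_values m n (A : 'M[R[i]]_(m, n)) : set R :=
  [set l2norm (A *m v) | v in [set v : 'cV[R[i]]_n | l2norm v <= 1]].

Let unit_values_sup m n (A : 'M[R[i]]_(m, n)) : has_sup (unit_values A).
Proof.
split; first by exists (l2norm (A *m 0)); exists 0 => //=; rewrite l2norm0.
exists (\sum_i \sum_j Normc.normc (A i j)) => _ [v /= v1 <-].
apply: (le_trans (l2norm_mul_entries _ _)); rewrite ler_piMr//.
by do 2 apply: sumr_ge0 => ? _; exact: normc_ge0.
Qed.

Lemma opnorm_ge0 m n (A : 'M[R[i]]_(m, n)) : 0 <= opnorm A.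
Proof.
rewrite -(@l2norm0 m) -(mulmx0 _ A); apply: (ub_le_sup (unit_values_sup A).2).
by exists 0 => //=; rewrite l2norm0.
Qed.

Lemma l2norm_mul_le m n (A : 'M[R[i]]_(m, n)) v :
  l2norm (A *m v) <= opnorm A * l2norm v.
Proof.
have [v0|v0] := eqVneq (l2norm v) 0.
  by rewrite v0 (l2norm0_eq0 v0) mulmx0 l2norm0 mulr0.
have vp : 0 < l2norm v by rewrite lt0r v0 l2norm_ge0.
have nV : Normc.normc (l2norm v)^-1%:C = (l2norm v)^-1.
  by rewrite /= expr0n addr0 sqrtr_sqr ger0_norm ?invr_ge0 ?ltW.
rewrite -ler_pdivrMr//; apply: (ub_le_sup (unit_values_sup A).2).
exists ((l2norm v)^-1%:C *: v) => /=; first by rewrite l2normZ nV mulVf.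
by rewrite -scalemxAr l2normZ nV mulrC.
Qed.

Lemma opnorm_le m n (A : 'M[R[i]]_(m, n)) (c : R) : 0 <= c ->
  (forall v, l2norm (A *m v) <= c * l2norm v) -> opnorm A <= c.
Proof.
move=> c0 Ac; apply: (ge_sup (unit_values_sup A).1) => _ [v /= v1 <-].
by apply: (le_trans (Ac v)); rewrite ler_piMr.
Qed.

Lemma opnorm_le_entries m n (A : 'M[R[i]]_(m, n)) :
  opnorm A <= \sum_i \sum_j Normc.normc (A i j).
Proof.
apply: opnorm_le; last exact: l2norm_mul_entries.
by do 2 apply: sumr_ge0 => ? _; exact: normc_ge0.
Qed.

Lemma normc_le_opnorm m n (A : 'M[R[i]]_(m, n)) i j :
  Normc.normc (A i j) <= opnorm A.
Proof.
have := l2norm_mul_le A (delta_mx j 0); rewrite l2norm_delta mulr1.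
apply: le_trans; rewrite -colE.
have -> : A i j = col j A i 0 by rewrite mxE.
exact: normc_le_l2norm.
Qed.

Lemma opnormD m n (A B : 'M[R[i]]_(m, n)) : opnorm (A + B) <= opnorm A + opnorm B.
Proof.
apply: opnorm_le => [|v]; first by rewrite addr_ge0 ?opnorm_ge0.
rewrite mulmxDl mulrDl; apply: (le_trans (l2normD _ _)).
by apply: lerD; exact: l2norm_mul_le.
Qed.

Lemma opnormM m n k (A : 'M[R[i]]_(m, n)) (B : 'M[R[i]]_(n, k)) :
  opnorm (A *m B) <= opnorm A * opnorm B.
Proof.
apply: opnorm_le => [|v]; first by rewrite mulr_ge0 ?opnorm_ge0.
rewrite -mulmxA -mulrA; apply: (le_trans (l2norm_mul_le _ _)).
by rewrite ler_wpM2l ?opnorm_ge0 ?l2norm_mul_le.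
Qed.

Lemma opnormN m n (A : 'M[R[i]]_(m, n)) : opnorm (- A) = opnorm A.
Proof.
suff le (B : 'M[R[i]]_(m, n)) : opnorm (- B) <= opnorm B.
  by apply/le_anti; rewrite le -{1}[A]opprK le.
apply: opnorm_le => [|v]; first exact: opnorm_ge0.
by rewrite mulNmx l2normN; exact: l2norm_mul_le.
Qed.

Lemma opnorm_distC m n (A B : 'M[R[i]]_(m, n)) : opnorm (A - B) = opnorm (B - A).
Proof. by rewrite -opnormN opprB. Qed.

Lemma opnorm_adj m n (A : 'M[R[i]]_(m, n)) : opnorm (A^t*) = opnorm A.
Proof.
suff le p q (B : 'M[R[i]]_(p, q)) : opnorm (B^t*) <= opnorm B.
  by apply/le_anti; rewrite le -{1}[A]trmxCK le.
apply: opnorm_le => [|v]; first exact: opnorm_ge0.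
have [->|v0] := eqVneq (l2norm (B^t* *m v)) 0.
  by rewrite mulr_ge0 ?opnorm_ge0 ?l2norm_ge0.
(* |B^* v|^2 = <v, B B^* v> <= |v| |B| |B^* v|; cancel one factor. *)
have vp : 0 < l2norm (B^t* *m v) by rewrite lt0r v0 l2norm_ge0.
rewrite -(ler_pM2r vp) -expr2 sqr_l2norm rdot_adj trmxCK.
apply: (le_trans (rdot_le _ _)).
rewrite [opnorm B * _]mulrC -mulrA ler_wpM2l ?l2norm_ge0//.
exact: l2norm_mul_le.
Qed.

Lemma opnorm1_le n : opnorm (1%:M : 'M[R[i]]_n) <= 1.
Proof. by apply: opnorm_le => // v; rewrite mul1mx mul1r. Qed.

Lemma opnorm_eq0 m n (A : 'M[R[i]]_(m, n)) : opnorm A <= 0 -> A = 0.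
Proof.
move=> A0; apply/matrixP => i j; rewrite mxE; apply: Normc.eq0_normc.
apply/le_anti; rewrite normc_ge0 andbT; exact: le_trans (normc_le_opnorm _ _ _) A0.
Qed.

Lemma opnorm_le_distD m n (A B : 'M[R[i]]_(m, n)) :
  opnorm A <= opnorm B + opnorm (A - B).
Proof. by rewrite -{1}[A](subrK B) addrC; exact: opnormD. Qed.

End OperatorNormTheory.

(** * Comparison of real quadratic forms *)

Section RealForms.
Set Implicit Arguments.
Unset Strict Implicit.
Context {R : realFieldType}.
Implicit Types a b c d e f m p x y r s t D M N X Y : R.

(** A positive definite binary form dominates its determinant divided by its trace
    times the square of the Euclidean norm. *)
Lemma coercive_form e f m x y : 0 < e -> 0 < f ->
  (e * f - m ^+ 2) / (e + f) * (x ^+ 2 + y ^+ 2)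
    <= e * x ^+ 2 + f * y ^+ 2 - 2 * m * (x * y).
Proof.
move=> e0 f0; rewrite mulrAC ler_pdivrMr ?addr_gt0// -subr_ge0.
rewrite [leRHS](_ : _ = (e * x - m * y) ^+ 2 + (f * y - m * x) ^+ 2);
  last by ring.
by rewrite addr_ge0 ?sqr_ge0.
Qed.

(** N and N' are to be the squared norms of a vector with coordinates of norms x
    and y, and of its image; r is the inner product of the coordinates. A loss
    N - N' bounded below by a positive definite form in x and y is at least a fixed
    fraction of N, since N itself is bounded by a multiple of x^2 + y^2. *)
Lemma contraction_constant e f d p b :
  0 < e -> e <= 1 -> 0 < f -> 0 <= p -> 0 < b -> (p * d) ^+ 2 < e * f ->
  exists2 c, 0 <= c < 1 & forall x y r N N', - (x * y) <= r ->
    N = x ^+ 2 - 2 * p * r + b * y ^+ 2 ->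
    e * x ^+ 2 + f * y ^+ 2 - 2 * (p * d) * (x * y) <= N - N' -> N' <= c * N.
Proof.
move=> e0 e1 f0 p0 b0 ef.
(* g comes from [coercive_form], and s bounds N / (x ^+ 2 + y ^+ 2). *)
pose g := (e * f - (p * d) ^+ 2) / (e + f); pose s := 1 + p + b.
have s0 : 0 < s by rewrite ltr_wpDl// addr_ge0.
have g0 : 0 < g by apply: divr_gt0; [rewrite subr_gt0 | exact: addr_gt0].
exists (1 - g / s).
  rewrite gtrBl divr_gt0// andbT subr_ge0 ler_pdivrMr// mul1r.
  rewrite ler_pdivrMr ?addr_gt0// -subr_ge0.
  rewrite [leRHS](_ : _ = (p * d) ^+ 2 + e + (1 - e) * f + (p + b) * (e + f));
    last by rewrite /s; ring.
  rewrite !addr_ge0 ?sqr_ge0 ?(ltW e0)// mulr_ge0 ?subr_ge0 ?addr_ge0//; exact: ltW.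
move=> x y r N N' xyr NE gap.
have size : N <= s * (x ^+ 2 + y ^+ 2).
  rewrite -subr_ge0 NE [leRHS](_ : _ =
    p * (x - y) ^+ 2 + 2 * (p * (r - - (x * y))) + b * x ^+ 2 + y ^+ 2);
    last by rewrite /s; ring.
  have t1 : 0 <= p * (x - y) ^+ 2 by exact: mulr_ge0 p0 (sqr_ge0 _).
  have t2 : 0 <= p * (r - - (x * y)) by rewrite mulr_ge0// subr_ge0.
  have t3 : 0 <= b * x ^+ 2 by exact: mulr_ge0 (ltW b0) (sqr_ge0 _).
  by rewrite !addr_ge0 ?sqr_ge0// mulr_ge0.
have := ler_wpM2l (ltW (divr_gt0 g0 s0)) size; rewrite mulrA divfK ?gt_eqF//.
have := le_trans (coercive_form (p * d) x y e0 f0) gap; rewrite -/g.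
rewrite mulrBl mul1r; lra.
Qed.

(** Here X and Y are squared norms of M v and v. The hypothesis is the positivity of
    a form at (t M v, v) for the choice t = a^-1, which is the best one for the
    resulting bound on X. *)
Lemma optimal_scaling a b c X Y r s : 0 < a -> 0 <= b ->
  r <= a * X -> s <= c * Y ->
  0 <= a^-1 * (a^-1 * r) - 2 * (a^-1 * X) + b * s -> X <= a * (b * c) * Y.
Proof.
move=> a0 b0 rX sY.
have rX' : a^-1 * (a^-1 * r) <= a^-1 * X.
  by rewrite ler_pM2l ?invr_gt0// mulrC ler_pdivrMr// mulrC.
have := ler_wpM2l b0 sY => bs h.
have : a^-1 * X <= b * (c * Y) by lra.
by rewrite mulrC ler_pdivrMr// => /le_trans; apply; rewrite mulrC !mulrA.
Qed.

(** The infimum over the admissible b: the condition b > 1 is absorbed by the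
    condition b > D / (e f). *)
Lemma optimal_coefficient a c e f D M :
  0 < e -> 0 < f -> 0 < a -> 0 < c -> 1 <= D / (e * f) ->
  (forall b, 1 < b -> D < e * (b * f) -> M <= a * (b * c)) ->
  M <= a / e * (c / f) * D.
Proof.
move=> e0 f0 a0 c0 D1 bound; apply/ler_addgt0Pr => t t0.
have [e1 f1 a1 c1] :=
  And4 (lt0r_neq0 e0) (lt0r_neq0 f0) (lt0r_neq0 a0) (lt0r_neq0 c0).
have t1 : 0 < t / (a * c) by rewrite divr_gt0 ?mulr_gt0.
(* The slack t is spent by exceeding the least b by t / (a c). *)
have -> : a / e * (c / f) * D + t = a * ((D / (e * f) + t / (a * c)) * c).
  by field; rewrite e1 f1 a1 c1.
apply: bound; first by rewrite (le_lt_trans D1)// ltrDl.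
rewrite [ltRHS](_ : _ = D + t / (a * c) * (e * f)).
  by rewrite ltrDl mulr_gt0// mulr_gt0.
by field; rewrite e1 f1 a1 c1.
Qed.

End RealForms.

(** * Operators glued along two intertwiners *)

Section Gram.
Set Implicit Arguments.
Unset Strict Implicit.
Context {R : realType}.

Definition defect n (A B : 'M[R[i]]_n) : 'M[R[i]]_n := 1%:M - A^t* *m B.

Lemma mul_defect n (A B : 'M[R[i]]_n) (v : 'cV_n) :
  defect A B *m v = v - A^t* *m (B *m v).
Proof. by rewrite /defect mulmxBl mul1mx mulmxA. Qed.

Lemma rdot_defect n (A B : 'M[R[i]]_n) v w :
  rdot v (defect A B *m w) = rdot v w - rdot (A *m v) (B *m w).
Proof. by rewrite mul_defect rdotBr rdot_adj. Qed.

#[local] Opaque defect opnorm.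

Lemma opnorm_sqr_lt1 n (A : 'M[R[i]]_n) : opnorm A < 1 -> 0 < 1 - opnorm A ^+ 2.
Proof. by move=> A1; rewrite subr_gt0 expr_lt1 ?opnorm_ge0. Qed.

Lemma rdot_defect_ge n (A : 'M[R[i]]_n) v :
  (1 - opnorm A ^+ 2) * l2norm v ^+ 2 <= rdot v (defect A A *m v).
Proof.
rewrite rdot_defect -!sqr_l2norm mulrBl mul1r lerB// -exprMn.
by rewrite ler_pXn2r ?nnegrE ?mulr_ge0 ?opnorm_ge0 ?l2norm_ge0// l2norm_mul_le.
Qed.

Lemma rdot_mul_le n (A : 'M[R[i]]_n) v w :
  rdot v (A *m w) <= opnorm A * (l2norm v * l2norm w).
Proof.
apply: (le_trans (rdot_le _ _)).
by rewrite mulrCA ler_wpM2l ?l2norm_ge0 ?l2norm_mul_le.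
Qed.

(** A vector F1 v1 + F2 v2 is handled through its coordinates (v1, v2); the Gram
    relations say that the norm is then a form with scalar coefficients 1, -p, b.
    The value p = 0 is used for direct sums and p = 1 for the two-point
    inequality. *)
Context (m k : nat) (F1 F2 : 'M[R[i]]_(m, k)) (p b : R).
Context (F11 : F1^t* *m F1 = 1%:M).
Context (F12 : F1^t* *m F2 = (- p)%:C%:M).
Context (F22 : F2^t* *m F2 = b%:C%:M).

Lemma gram_norm (v1 v2 : 'cV_k) : l2norm (F1 *m v1 + F2 *m v2) ^+ 2 =
  l2norm v1 ^+ 2 - 2 * p * rdot v1 v2 + b * l2norm v2 ^+ 2.
Proof.
have E11 : rdot (F1 *m v1) (F1 *m v1) = rdot v1 v1.
  by rewrite rdot_adj mulmxA F11 mul1mx.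
have E12 : rdot (F1 *m v1) (F2 *m v2) = - p * rdot v1 v2.
  by rewrite rdot_adj mulmxA F12 mul_scalar_mx rdotZr.
have E22 : rdot (F2 *m v2) (F2 *m v2) = b * rdot v2 v2.
  by rewrite rdot_adj mulmxA F22 mul_scalar_mx rdotZr.
rewrite !sqr_l2norm rdotDl !rdotDr (rdotC (F2 *m v2) (F1 *m v1)) E11 E12 E22.
by move: (rdot v1 v1) (rdot v1 v2) (rdot v2 v2) => x y z; ring.
Qed.

Context (A : 'M[R[i]]_m) (B1 B2 : 'M[R[i]]_k).
Context (AF1 : A *m F1 = F1 *m B1) (AF2 : A *m F2 = F2 *m B2).

(** In coordinates A acts as (B1, B2), so the loss of norm under A is the same form
    evaluated with the three defects of B1 and B2 inserted. *)
Lemma gram_defect (v1 v2 : 'cV_k) :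
  l2norm (F1 *m v1 + F2 *m v2) ^+ 2 - l2norm (A *m (F1 *m v1 + F2 *m v2)) ^+ 2
  = rdot v1 (defect B1 B1 *m v1) - 2 * p * rdot v1 (defect B1 B2 *m v2)
    + b * rdot v2 (defect B2 B2 *m v2).
Proof.
rewrite mulmxDr !mulmxA AF1 AF2 -!mulmxA !gram_norm !rdot_defect !sqr_l2norm.
move: (rdot v1 v1) (rdot v1 v2) (rdot v2 v2).
move: (rdot (B1 *m v1) (B1 *m v1)) (rdot (B1 *m v1) (B2 *m v2)).
move: (rdot (B2 *m v2) (B2 *m v2)) => *; ring.
Qed.

(** G1 and G2 witness that F1 and F2 together are onto. The assumption on the
    off-diagonal defect makes the form of [gram_defect] positive definite. *)
Lemma opnorm_gram_lt1 (G1 G2 : 'M[R[i]]_(k, m)) :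
  F1 *m G1 + F2 *m G2 = 1%:M -> 0 <= p -> 0 < b ->
  opnorm B1 < 1 -> opnorm B2 < 1 ->
  (p * opnorm (defect B1 B2)) ^+ 2
    < (1 - opnorm B1 ^+ 2) * (b * (1 - opnorm B2 ^+ 2)) ->
  opnorm A < 1.
Proof.
move=> FG p0 b0 B1lt B2lt ef.
have [||c /andP[c0 c1] contr] :=
    contraction_constant (opnorm_sqr_lt1 B1lt) _ _ p0 b0 ef.
- by rewrite gerBl sqr_ge0.
- by rewrite mulr_gt0 ?opnorm_sqr_lt1.
apply: (@le_lt_trans _ _ (Num.sqrt c)); last first.
  by rewrite -[ltRHS]sqrtr1 ltr_sqrt.
apply: opnorm_le => [|w]; first exact: sqrtr_ge0.
rewrite -(@ler_pXn2r _ 2) ?nnegrE ?mulr_ge0 ?l2norm_ge0 ?sqrtr_ge0//.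
rewrite exprMn (sqr_sqrtr c0) -[w]mul1mx -FG mulmxDl -!mulmxA.
apply: (contr _ _ _ _ _ _ (gram_norm _ _)).
  by rewrite lerNl -rdotNl -(l2normN (G1 *m w)) rdot_le.
rewrite gram_defect addrAC lerD//; last first.
  by rewrite -[leLHS]mulrA ler_pM2l// rdot_defect_ge.
rewrite lerB ?rdot_defect_ge// -[leLHS]mulrA -(mulrA 2 (p * _)) ler_pM2l//.
by rewrite -mulrA ler_wpM2l// rdot_mul_le.
Qed.

(** Conversely, if A is a contraction, the form of [gram_defect] is nonnegative, and
    its value at a multiple of M v and v, where M is the off-diagonal defect, bounds
    |M v|. *)
Lemma opnorm_defect_cross : p = 1 -> 0 <= b -> opnorm A <= 1 ->
  0 < opnorm (defect B1 B1) ->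
  opnorm (defect B1 B2) ^+ 2 <=
    opnorm (defect B1 B1) * (b * opnorm (defect B2 B2)).
Proof.
move=> p1 b0 A1 a0; set M := defect B1 B2.
have abc0 : 0 <= opnorm (defect B1 B1) * (b * opnorm (defect B2 B2)).
  by rewrite !mulr_ge0 ?opnorm_ge0.
rewrite -(sqr_sqrtr abc0) ler_pXn2r ?nnegrE ?opnorm_ge0 ?sqrtr_ge0//.
apply: opnorm_le => [|v]; first exact: sqrtr_ge0.
rewrite -(@ler_pXn2r _ 2) ?nnegrE ?mulr_ge0 ?l2norm_ge0 ?sqrtr_ge0//.
rewrite exprMn (sqr_sqrtr abc0).
set a := opnorm (defect B1 B1) in a0 *; set c := opnorm (defect B2 B2).
have := gram_defect (a^-1%:C *: (M *m v)) v.
rewrite p1 mulr1 -/M -!scalemxAr !rdotZl !rdotZr -sqr_l2norm => gap.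
have h1 := rdot_mul_le (defect B1 B1) (M *m v) (M *m v).
have h2 := rdot_mul_le (defect B2 B2) v v.
rewrite -!expr2 in h1 h2; apply: (optimal_scaling a0 b0 h1 h2).
rewrite -gap subr_ge0 ler_pXn2r ?nnegrE ?l2norm_ge0//.
by apply: (le_trans (l2norm_mul_le _ _)); rewrite ler_piMl ?l2norm_ge0.
Qed.

End Gram.

(** * Evaluation of noncommutative polynomials *)

Section Noncommutative.
Set Implicit Arguments.
Unset Strict Implicit.
Context {R : realType} {d : nat}.

(** A relation x_r F = F y_r propagates to words by moving F across one letter at a
    time. *)
Lemma nceval_intertwine (p : ncpoly R d) n m (x : mtuple R d n)
    (y : mtuple R d m) (F : 'M[R[i]]_(n, m)) :
  (forall r, x 0 r *m F = F *m y 0 r) -> nceval p x *m F = F *m nceval p y.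
Proof.
move=> xF; rewrite /nceval mulmx_suml mulmx_sumr; apply: eq_bigr => w _.
rewrite -scalemxAl -scalemxAr; congr (_ *: _).
elim: (fmonom_val w) => [|r s IH]; first by rewrite !big_nil mul1mx mulmx1.
by rewrite !big_cons -!mulmxE -mulmxA IH !mulmxA xF.
Qed.

Lemma mxeval_intertwine J (delta : 'M[ncpoly R d]_J) n m (x : mtuple R d n)
    (y : mtuple R d m) (F : 'M[R[i]]_(n, m)) :
  (forall r, x 0 r *m F = F *m y 0 r) ->
  mxeval delta x *m tensmx 1%:M F = tensmx 1%:M F *m mxeval delta y.
Proof.
move=> xF; rewrite /mxeval mulmx_suml mulmx_sumr; apply: eq_bigr => i _.
rewrite mulmx_suml mulmx_sumr; apply: eq_bigr => j _.
by rewrite !tensmx_mul mul1mx mulmx1 (nceval_intertwine _ xF).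
Qed.

Lemma tens1_adj J n m (F : 'M[R[i]]_(n, m)) :
  (tensmx 1%:M F : 'M_(J * n, J * m))^t* = tensmx 1%:M (F^t*).
Proof. by rewrite trmx_tens map_mxT trmx1 map_mx1. Qed.

Lemma tens1_scalar J n (c : R[i]) :
  tensmx (1%:M : 'M_J) (c%:M : 'M_n) = c%:M.
Proof.
apply/matrixP => i j; case: (mxtens_indexP i) => i0 i1.
case: (mxtens_indexP j) => j0 j1; rewrite tensmxE !mxE.
rewrite (inj_eq (can_inj (@mxtens_indexK _ _))) xpair_eqE.
by case: (i0 == j0); case: (i1 == j1); rewrite /= ?mulr0n ?mulr1n ?mul0r ?mul1r.
Qed.

(** Tensoring with the identity of C^J turns intertwiners of the tuples into
    intertwiners of the values of delta without changing the Gram relations, so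
    membership in the polyhedron is an instance of [opnorm_gram_lt1]. *)
Lemma polyhedron_glue J (delta : 'M[ncpoly R d]_J) n m (X : mtuple R d m)
    (Y Z : mtuple R d n) (F1 F2 : 'M[R[i]]_(m, n)) (G1 G2 : 'M[R[i]]_(n, m))
    (p b : R) :
  F1^t* *m F1 = 1%:M -> F1^t* *m F2 = (- p)%:C%:M -> F2^t* *m F2 = b%:C%:M ->
  F1 *m G1 + F2 *m G2 = 1%:M -> 0 <= p -> 0 < b ->
  (forall r, X 0 r *m F1 = F1 *m Y 0 r) ->
  (forall r, X 0 r *m F2 = F2 *m Z 0 r) ->
  (0 < m)%N -> polyhedron delta Y -> polyhedron delta Z ->
  (p * opnorm (defect (mxeval delta Y) (mxeval delta Z))) ^+ 2
    < (1 - opnorm (mxeval delta Y) ^+ 2)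
      * (b * (1 - opnorm (mxeval delta Z) ^+ 2)) ->
  polyhedron delta X.
Proof.
move=> F11 F12 F22 FG p0 b0 XY XZ m0 [_ Y1] [_ Z1] gap; split=> //.
apply: (opnorm_gram_lt1 (F1 := tensmx 1%:M F1) (F2 := tensmx 1%:M F2)
  (G1 := tensmx 1%:M G1) (G2 := tensmx 1%:M G2) _ _ _ _ _ _ p0 b0 Y1 Z1 gap).
- by rewrite tens1_adj tensmx_mul F11 mulmx1 tens1_scalar.
- by rewrite tens1_adj tensmx_mul F12 mulmx1 tens1_scalar.
- by rewrite tens1_adj tensmx_mul F22 mulmx1 tens1_scalar.
- exact: mxeval_intertwine.
- exact: mxeval_intertwine.
rewrite !tensmx_mul mulmx1 -(tens1_scalar J m 1) -FG.
by apply/matrixP => i j; rewrite !mxE mulrDr.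
Qed.

Lemma dsum_col n m (x : mtuple R d n) (y : mtuple R d m) r k
    (A : 'M[R[i]]_(n, k)) (B : 'M[R[i]]_(m, k)) :
  dsum x y 0 r *m col_mx A B = col_mx (x 0 r *m A) (y 0 r *m B).
Proof. by rewrite mxE mul_block_col !mul0mx addr0 add0r. Qed.

Lemma polyhedron_dsum J (delta : 'M[ncpoly R d]_J) n (Y Z : mtuple R d n) :
  polyhedron delta Y -> polyhedron delta Z -> polyhedron delta (dsum Y Z).
Proof.
move=> PY PZ; pose F1 : 'M[R[i]]_(n + n, n) := col_mx 1%:M 0.
pose F2 : 'M[R[i]]_(n + n, n) := col_mx 0 1%:M.
apply: (polyhedron_glue (F1 := F1) (F2 := F2) (G1 := F1^T) (G2 := F2^T)
  (p := 0) (b := 1) (Y := Y) (Z := Z)) => //.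
- rewrite /F1 tr_col_mx map_row_mx mul_row_col trmx1 trmx0 map_mx1 map_mx0.
  by rewrite mul1mx mul0mx addr0.
- rewrite /F1 /F2 tr_col_mx map_row_mx mul_row_col trmx1 trmx0 map_mx1 map_mx0.
  by rewrite mul0mx mulmx0 addr0 oppr0 raddf0.
- rewrite /F2 tr_col_mx map_row_mx mul_row_col trmx1 trmx0 map_mx1 map_mx0.
  by rewrite mul1mx mul0mx add0r.
- rewrite /F1 /F2 !tr_col_mx !mul_col_row !trmx1 !trmx0 !mulmx0 !mul1mx !mul0mx.
  by rewrite add_block_mx !addr0 !add0r -scalar_mx_block.
- by move=> r; rewrite /F1 dsum_col mul_col_mx !mulmx0 mul0mx mul1mx mulmx1.
- by move=> r; rewrite /F2 dsum_col mul_col_mx !mulmx0 mul0mx mul1mx mulmx1.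
- by case: PY => n0 _; rewrite addn_gt0 n0.
rewrite mul0r expr0n/= mul1r; case: PY PZ => _ Y1 [_ Z1].
by rewrite mulr_gt0 ?opnorm_sqr_lt1.
Qed.

End Noncommutative.

(** * The two-point Schwarz-Pick inequality *)

Section TwoPoint.
Set Implicit Arguments.
Unset Strict Implicit.
Context {R : realType}.

#[local] Opaque defect opnorm.

(** For a unit vector v, v = defect A B v + A^* B v; such a vector exists because
    n > 0. *)
Lemma opnorm_defect_lb n (A B : 'M[R[i]]_n) : (0 < n)%N ->
  1 - opnorm A * opnorm B <= opnorm (defect A B).
Proof.
move=> n0; pose v : 'cV[R[i]]_n := delta_mx (Ordinal n0) 0.
have v1 : l2norm v = 1 by exact: l2norm_delta.
have vE : v = defect A B *m v + A^t* *m (B *m v).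
  by rewrite mul_defect subrK.
rewrite lerBlDr -v1 {1}vE; apply: (le_trans (l2normD _ _)); apply: lerD.
  by have := l2norm_mul_le (defect A B) v; rewrite v1 mulr1.
apply: (le_trans (l2norm_mul_le _ _)).
rewrite opnorm_adj ler_wpM2l ?opnorm_ge0//.
by have := l2norm_mul_le B v; rewrite v1 mulr1.
Qed.

Lemma opnorm_defect_gt0 n (A B : 'M[R[i]]_n) : (0 < n)%N ->
  opnorm A < 1 -> opnorm B < 1 -> 0 < opnorm (defect A B).
Proof.
move=> n0 A1 B1; apply: lt_le_trans (opnorm_defect_lb A B n0).
move: (opnorm A) (opnorm B) (opnorm_ge0 A) A1 B1 => a b a0 a1 b1.
by rewrite subr_gt0 (@le_lt_trans _ _ a)// ler_piMr// ltW.
Qed.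

(** This reduces to (1 - a b)^2 - (1 - a^2) (1 - b^2) = (a - b)^2 for the norms a
    and b. *)
Lemma defect_ratio_ge1 n (A B : 'M[R[i]]_n) : (0 < n)%N ->
  opnorm A < 1 -> opnorm B < 1 ->
  1 <= opnorm (defect A B) ^+ 2 / ((1 - opnorm A ^+ 2) * (1 - opnorm B ^+ 2)).
Proof.
move=> n0 A1 B1.
have lb := opnorm_defect_lb A B n0.
rewrite ler_pdivlMr ?mulr_gt0 ?opnorm_sqr_lt1// mul1r.
move: (opnorm A) (opnorm B) (opnorm (defect A B)) (opnorm_ge0 A) (opnorm_ge0 B)
  (opnorm_ge0 (defect A B)) A1 B1 lb => a b c a0 b0 c0 a1 b1 lb.
have ab1 : a * b <= 1 by rewrite mulr_ile1// ltW.
apply: (@le_trans _ _ ((1 - a * b) ^+ 2)); last first.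
  by rewrite ler_pXn2r ?nnegrE ?subr_ge0.
rewrite -subr_ge0 [leRHS](_ : _ = (a - b) ^+ 2) ?sqr_ge0//; ring.
Qed.

Lemma glued_columns n (F1 F2 : 'M[R[i]]_(n + n, n)) S (A B : 'M[R[i]]_n) :
  S *m row_mx F1 F2 = 1%:M ->
  row_mx F1 F2 *m block_mx A 0 0 B *m S *m F1 = F1 *m A /\
  row_mx F1 F2 *m block_mx A 0 0 B *m S *m F2 = F2 *m B.
Proof.
move=> SF; apply: eq_row_mx; rewrite -mul_mx_row -mulmxA SF mulmx1.
by rewrite mul_row_block !mulmx0 addr0 add0r.
Qed.

(** The similarity by the block matrix with columns F1 and F2 moves the direct sum
    of Y and Z to a point X of the polyhedron at which phi is known. *)
Lemma schur_gram d J (delta : 'M[ncpoly R d]_J) phi n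
    (Y Z : mtuple R d n) (b : R) :
  schur_class delta phi -> polyhedron delta Y -> polyhedron delta Z ->
  1 < b ->
  opnorm (defect (mxeval delta Y) (mxeval delta Z)) ^+ 2
    < (1 - opnorm (mxeval delta Y) ^+ 2)
      * (b * (1 - opnorm (mxeval delta Z) ^+ 2)) ->
  opnorm (defect (phi n Y) (phi n Z)) ^+ 2 <=
    opnorm (defect (phi n Y) (phi n Y))
      * (b * opnorm (defect (phi n Z) (phi n Z))).
Proof.
move=> [[phiD phiS] phi1] PY PZ b1 gap.
have b0 : 0 < b by exact: lt_trans b1.
have q0 : 0 < b - 1 by rewrite subr_gt0.
(* With this q the second column [-1; q] has squared norm 1 + (b - 1) = b. *)
pose q : R[i] := (Num.sqrt (b - 1))%:C.
have qneq0 : q != 0.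
  by rewrite (inj_eq (@complexI _)) gt_eqF// sqrtr_gt0.
have qq : Num.conj q * q = (b - 1)%:C.
  have -> : Num.conj q = q by exact: conjc_real.
  by rewrite -rmorphM -expr2 sqr_sqrtr// ltW.
pose F1 : 'M[R[i]]_(n + n, n) := col_mx 1%:M 0.
pose F2 : 'M[R[i]]_(n + n, n) := col_mx (-1)%:M q%:M.
pose G1 : 'M[R[i]]_(n, n + n) := row_mx 1%:M q^-1%:M.
pose G2 : 'M[R[i]]_(n, n + n) := row_mx 0 q^-1%:M.
have F11 : F1^t* *m F1 = 1%:M.
  rewrite /F1 tr_col_mx map_row_mx mul_row_col trmx1 trmx0 map_mx1 map_mx0.
  by rewrite mul1mx mul0mx addr0.
have N1 : (-1 : R)%:C = -1 :> R[i] by rewrite rmorphN rmorph1.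
have F12 : F1^t* *m F2 = (- 1)%:C%:M.
  rewrite /F1 /F2 tr_col_mx map_row_mx mul_row_col trmx1 trmx0 map_mx1 map_mx0.
  by rewrite mul1mx mul0mx addr0 N1.
have F22 : F2^t* *m F2 = b%:C%:M.
  rewrite /F2 tr_col_mx map_row_mx mul_row_col !tr_scalar_mx !map_scalar_mx.
  rewrite -!scalar_mxM rmorphN1 mulrNN mulr1 [X in _ + X%:M](qq) -raddfD/=.
  by rewrite -(rmorph1 (real_complex R)) -rmorphD/= addrC subrK.
(* V is S^-1, so that similar V conjugates by S. *)
pose V := col_mx G1 G2.
have FV : row_mx F1 F2 *m V = 1%:M.
  rewrite /V mul_row_col /F1 /F2 /G1 /G2 !mul_col_row -!scalar_mxM.
  rewrite !mulmx0 !mul0mx !mul1r add_block_mx !addr0 !add0r divff// mulN1r.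
  by rewrite raddfN subrr -scalar_mx_block.
have VF : V *m row_mx F1 F2 = 1%:M by exact: mulmx1C.
have uV : V \in unitmx by case: (mulmx1_unit VF).
have VE : invmx V = row_mx F1 F2.
  by rewrite -[LHS]mulmx1 -VF mulmxA mulVmx// mul1mx.
have n0 : (0 < n + n)%N by case: PY => n0 _; rewrite addn_gt0 n0.
pose X := Defs.similar V (dsum Y Z).
have [XY XZ] : (forall r, X 0 r *m F1 = F1 *m Y 0 r) /\
               (forall r, X 0 r *m F2 = F2 *m Z 0 r).
  by split=> r; rewrite !mxE VE; case: (glued_columns (Y 0 r) (Z 0 r) VF).
have PX : polyhedron delta X.
  apply: (polyhedron_glue F11 F12 F22 _ ler01 b0 XY XZ n0 PY PZ).
    by rewrite -mul_row_col; exact: FV.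
  by rewrite mul1r.
have PD := polyhedron_dsum PY PZ.
have phiX : phi _ X = row_mx F1 F2 *m block_mx (phi n Y) 0 0 (phi n Z) *m V.
  by rewrite (phiS _ _ _ uV PD PX) (phiD _ _ _ _ PY PZ PD) VE.
have [AF1 AF2] := glued_columns (phi n Y) (phi n Z) VF; rewrite -phiX in AF1 AF2.
apply: (opnorm_defect_cross F11 F12 F22 AF1 AF2) => //.
- exact: ltW.
- exact: ltW (phi1 _ _ PX).
by apply: opnorm_defect_gt0; [case: PY | exact: phi1 ..].
Qed.

(** Positivity of J matters: for J = 0 the polyhedron is everything and the right
    hand side vanishes. *)
Lemma schur_two_point d J (delta : 'M[ncpoly R d]_J) phi n
    (Y Z : mtuple R d n) :
  (0 < J)%N ->
  schur_class delta phi -> polyhedron delta Y -> polyhedron delta Z ->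
  opnorm (defect (phi n Y) (phi n Z)) ^+ 2 <=
    opnorm (defect (phi n Y) (phi n Y)) / (1 - opnorm (mxeval delta Y) ^+ 2)
    * (opnorm (defect (phi n Z) (phi n Z)) / (1 - opnorm (mxeval delta Z) ^+ 2))
    * opnorm (defect (mxeval delta Y) (mxeval delta Z)) ^+ 2.
Proof.
move=> J0 S PY PZ; have [n0 Y1] := PY; have [_ Z1] := PZ.
have gr b := @schur_gram _ _ delta phi n Y Z b S PY PZ.
have Jn0 : (0 < J * n)%N by rewrite muln_gt0 J0.
apply: (optimal_coefficient (opnorm_sqr_lt1 Y1) (opnorm_sqr_lt1 Z1)
  _ _ (defect_ratio_ge1 Jn0 Y1 Z1) gr).
- by apply: opnorm_defect_gt0 => //; exact: S.2.
- by apply: opnorm_defect_gt0 => //; exact: S.2.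
Qed.

End TwoPoint.

(** * Continuity in operator norm *)

Section NormContinuity.
Set Implicit Arguments.
Unset Strict Implicit.
Context {R : realType}.

#[local] Opaque opnorm.

Lemma nbhs_normc (z : R[i]) (e : R) : 0 < e ->
  nbhs z [set w : R[i] | Normc.normc (w - z) < e].
Proof.
move=> e0; have ec : 0 < e%:C :> R[i] by rewrite ltcE /= eqxx.
apply/nbhs_ballP; exists e%:C => //= w.
rewrite -ball_normE /ball_ /= -normrN opprB.
by rewrite ltcE /= => /andP[_].
Qed.

Lemma nbhs_opnorm m k (A : 'M[R[i]]_(m, k)) (e : R) : 0 < e ->
  nbhs A [set B : 'M[R[i]]_(m, k) | opnorm (B - A) < e].
Proof.
(* The successor leaves room for a strict inequality, also when m k = 0. *)
move=> e0; pose h := e / (m * k).+1%:R.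
have h0 : 0 < h by rewrite divr_gt0.
exists (fun i j => [set w | Normc.normc (w - A i j) < h]).
  by move=> i j; exact: nbhs_normc.
move=> B /= AB; apply: (le_lt_trans (opnorm_le_entries _)).
apply: (@le_lt_trans _ _ (\sum_(i < m) \sum_(j < k) h)).
  apply: ler_sum => i _; apply: ler_sum => j _.
  by rewrite !mxE ltW// AB.
rewrite !sumr_const !card_ord -mulrnA mulnC -mulr_natr /h mulrAC.
by rewrite ltr_pdivrMr// ltr_pM2l// ltr_nat.
Qed.

Lemma nbhs_tuple d n (T : mtuple R d n) (e : R) : 0 < e ->
  nbhs T [set Z : mtuple R d n | forall r, opnorm (Z 0 r - T 0 r) < e].
Proof.
move=> e0; exists (fun i r => [set B | opnorm (B - T i r) < e]).
  by move=> i r; exact: nbhs_opnorm.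
by move=> Z /= TZ r; exact: TZ.
Qed.

Lemma opnorm0 m k : opnorm (0 : 'M[R[i]]_(m, k)) = 0.
Proof.
apply/le_anti; rewrite opnorm_ge0 andbT; apply: opnorm_le => // v.
by rewrite mul0mx l2norm0 mul0r.
Qed.

Context (U : Type) (F : set_system U) {FF : Filter F}.

(** Convergence of matrices measured by the operator norm, so that only limits of
    real numbers are ever computed. *)
Definition opcvg m k (g : U -> 'M[R[i]]_(m, k)) (A : 'M[R[i]]_(m, k)) :=
  opnorm (g Z - A) @[Z --> F] --> (0 : R).

Lemma opcvg_le m k (g : U -> 'M[R[i]]_(m, k)) A (h : U -> R) :
  (forall Z, opnorm (g Z - A) <= h Z) -> h Z @[Z --> F] --> (0 : R) ->
  opcvg g A.
Proof.
move=> gh h0; apply: (squeeze_cvgr _ (cvg_cst 0) h0).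
by apply: nearW => Z; rewrite opnorm_ge0 gh.
Qed.

Lemma opcvg_near m k (g : U -> 'M[R[i]]_(m, k)) A (e : R) :
  opcvg g A -> 0 < e -> F [set Z | opnorm (g Z - A) < e].
Proof.
move=> /cvgr0Pnorm_lt gA e0; apply: filterS (gA e e0) => Z /=.
by rewrite ger0_norm ?opnorm_ge0.
Qed.

Lemma opcvg_cst m k (A : 'M[R[i]]_(m, k)) : opcvg (fun=> A) A.
Proof. by rewrite /opcvg subrr opnorm0; exact: cvg_cst. Qed.

Lemma opcvgD m k (f g : U -> 'M[R[i]]_(m, k)) A B :
  opcvg f A -> opcvg g B -> opcvg (fun Z => f Z + g Z) (A + B).
Proof.
move=> fA gB.
apply: (opcvg_le (h := fun Z => opnorm (f Z - A) + opnorm (g Z - B))).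
  by move=> Z; rewrite opprD addrACA opnormD.
have := cvgD fA gB; rewrite addr0; exact.
Qed.

Lemma opcvg_sum m k I (s : seq I) (f : I -> U -> 'M[R[i]]_(m, k)) A :
  (forall i, opcvg (f i) (A i)) ->
  opcvg (fun Z => \sum_(i <- s) f i Z) (\sum_(i <- s) A i).
Proof.
move=> fA; elim: s => [|i s IH].
  rewrite big_nil; under [fun _ => _]eq_fun do rewrite big_nil.
  exact: opcvg_cst.
rewrite big_cons; under [fun _ => _]eq_fun do rewrite big_cons.
exact: opcvgD (fA i) IH.
Qed.

Lemma opcvgM m k l (f : U -> 'M[R[i]]_(m, k)) (g : U -> 'M[R[i]]_(k, l)) A B :
  opcvg f A -> opcvg g B -> opcvg (fun Z => f Z *m g Z) (A *m B).
Proof.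
move=> fA gB; apply: (opcvg_le (h := fun Z =>
  opnorm (f Z - A) * opnorm (g Z - B)
  + (opnorm (f Z - A) * opnorm B + opnorm A * opnorm (g Z - B)))).
  move=> Z; rewrite (_ : _ - _ = (f Z - A) *m (g Z - B)
      + ((f Z - A) *m B + A *m (g Z - B))).
    apply: (le_trans (opnormD _ _)); apply: lerD; first exact: opnormM.
    by apply: (le_trans (opnormD _ _)); apply: lerD; exact: opnormM.
  rewrite addrA -mulmxDr subrK mulmxBl mulmxBr.
  by rewrite addrA subrK.
have z : 0 * 0 + (0 * opnorm B + opnorm A * 0) = 0 :> R.
  by rewrite !mulr0 mul0r !addr0.
have := cvgD (cvgM fA gB)
  (cvgD (cvgM fA (cvg_cst (opnorm B))) (cvgM (cvg_cst (opnorm A)) gB)).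
rewrite z; exact.
Qed.

(** A crude bound; only its linearity in the norm of A matters. *)
Lemma opnorm_tens_le m k n l (D : 'M[R[i]]_(m, k)) (A : 'M[R[i]]_(n, l)) :
  opnorm (tensmx D A) <= (\sum_(i < m * n) \sum_(j < k * l) Normc.normc
    (D (mxtens_unindex i).1 (mxtens_unindex j).1)) * opnorm A.
Proof.
apply: (le_trans (opnorm_le_entries _)).
rewrite mulr_suml; apply: ler_sum => i _.
rewrite mulr_suml; apply: ler_sum => j _.
by rewrite mxE Normc.normcM ler_wpM2l ?normc_ge0// normc_le_opnorm.
Qed.

Lemma opcvg_tens m k n l (D : 'M[R[i]]_(m, k)) (f : U -> 'M[R[i]]_(n, l)) A :
  opcvg f A -> opcvg (fun Z => tensmx D (f Z)) (tensmx D A).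
Proof.
move=> fA; apply: (opcvg_le (h := fun Z =>
    (\sum_(i < m * n) \sum_(j < k * l) Normc.normc
    (D (mxtens_unindex i).1 (mxtens_unindex j).1)) * opnorm (f Z - A))).
  move=> Z; rewrite (_ : _ - _ = tensmx D (f Z - A)) ?opnorm_tens_le//.
  by apply/matrixP => i j; rewrite !mxE mulrBr.
have := cvgM (cvg_cst (\sum_(i < m * n) \sum_(j < k * l) Normc.normc
    (D (mxtens_unindex i).1 (mxtens_unindex j).1))) fA; rewrite mulr0; exact.
Qed.

End NormContinuity.

Section EvalContinuity.
Set Implicit Arguments.
Unset Strict Implicit.
Context {R : realType} {d n : nat} (T : mtuple R d n).

Lemma nceval_opcvg (p : ncpoly R d) :
  opcvg (nbhs T) (fun Z => nceval p Z) (nceval p T).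
Proof.
apply: opcvg_sum => w.
under [fun _ => _]eq_fun do rewrite -mul_scalar_mx.
rewrite -mul_scalar_mx; apply: opcvgM; first exact: opcvg_cst.
have coord r : opcvg (nbhs T) (fun Z : mtuple R d n => Z 0 r) (T 0 r).
  apply/cvgr0Pnorm_lt => e e0; apply: filterS (nbhs_tuple T e0) => Z /(_ r).
  by rewrite ger0_norm ?opnorm_ge0.
elim: (fmonom_val w) => [|r s IH].
  rewrite big_nil; under [fun _ => _]eq_fun do rewrite big_nil.
  exact: opcvg_cst.
have -> : (fun Z : mtuple R d n => \prod_(t <- r :: s) Z 0 t) =
    fun Z => Z 0 r *m \prod_(t <- s) Z 0 t.
  by apply/funext => Z; rewrite big_cons -mulmxE.
by rewrite big_cons -mulmxE; exact: opcvgM (coord r) IH.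
Qed.

Lemma mxeval_opcvg J (delta : 'M[ncpoly R d]_J) :
  opcvg (nbhs T) (fun Z => mxeval delta Z) (mxeval delta T).
Proof.
do 2 apply: opcvg_sum => ?; apply: opcvg_tens; exact: nceval_opcvg.
Qed.

Lemma mxeval_near J (delta : 'M[ncpoly R d]_J) (e : R) : 0 < e ->
  nbhs T [set Z : mtuple R d n | opnorm (mxeval delta Z - mxeval delta T) < e].
Proof.
move=> e0.
exact: (@opcvg_near _ _ _ (nbhs_filter T) _ _ _ _ _ (mxeval_opcvg delta) e0).
Qed.

End EvalContinuity.

(** * Approach to a boundary point *)

Section BoundaryLimit.
Set Implicit Arguments.
Unset Strict Implicit.
Context {R : realType}.

#[local] Opaque defect opnorm.

Lemma normc_le_abs (z : R[i]) :
  Normc.normc z <= `|complex.Re z| + `|complex.Im z|.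
Proof.
rewrite -(@ler_pXn2r _ 2) ?nnegrE ?addr_ge0 ?normc_ge0//.
rewrite sqr_normc sqrrD !real_normK ?num_real// [leRHS]addrAC.
by rewrite lerDl mulrn_wge0// mulr_ge0.
Qed.

Lemma abs_le_normc (z : R[i]) :
  `|complex.Re z| <= Normc.normc z /\ `|complex.Im z| <= Normc.normc z.
Proof.
rewrite -!(@ler_pXn2r _ 2 _ `|_|) ?nnegrE ?normr_ge0 ?normc_ge0//.
by rewrite sqr_normc !real_normK ?num_real// lerDl lerDr !sqr_ge0.
Qed.

(** Real and imaginary parts of the entries range over a product of compact
    intervals. *)
Lemma unit_ball_cluster m k (u : nat -> 'M[R[i]]_(m, k)) :
  (forall N, opnorm (u N) <= 1) ->
  exists W, forall e N, 0 < e -> exists2 M, (N <= M)%N & opnorm (u M - W) < e.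
Proof.
move=> u1.
pose enc (A : 'M[R[i]]_(m, k)) : 'rV[R]_(m * k + m * k) :=
  row_mx (mxvec (map_mx (@complex.Re R) A)) (mxvec (map_mx (@complex.Im R) A)).
have encL A i j : enc A 0 (lshift _ (mxvec_index i j)) = complex.Re (A i j).
  by rewrite row_mxEl mxvecE mxE.
have encR A i j : enc A 0 (rshift _ (mxvec_index i j)) = complex.Im (A i j).
  by rewrite row_mxEr mxvecE mxE.
have K := @rV_compact R _ (fun _ : 'I_(m * k + m * k) => `[-1, 1]%classic)
  (fun _ => @segment_compact R (-1) 1).
have [|v [_ vcl]] := K (enc \o u @ \oo).
- exists 0%N => // N _ /= l; rewrite in_itv /= -ler_norml.
  rewrite -[l]splitK; case: (fintype.split l) => l' /=.
    case/mxvec_indexP: l' => i j; rewrite encL.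
    apply: le_trans (abs_le_normc _).1 _.
    exact: le_trans (normc_le_opnorm _ _ _) (u1 N).
  case/mxvec_indexP: l' => i j; rewrite encR.
  apply: le_trans (abs_le_normc _).2 _.
  exact: le_trans (normc_le_opnorm _ _ _) (u1 N).
pose W := \matrix_(i, j) ((v 0 (lshift _ (mxvec_index i j)))
  +i* (v 0 (rshift _ (mxvec_index i j)))) : 'M[R[i]]_(m, k).
exists W => e N e0.
pose h := e / (2 * (m * k).+1%:R).
have h0 : 0 < h by rewrite divr_gt0// mulr_gt0.
have [||w [[M /= NM <-] vw]] := vcl ((enc \o u) @` [set M | (N <= M)%N])
    [set w | forall l, `|w 0 l - v 0 l| < h].
- by exists N => // M /= NM; exists M.
- exists (fun _ l => [set x | `|x - v 0 l| < h]).
    move=> i l; rewrite (ord1 i); apply/nbhs_normP; exists h => //= x.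
    by rewrite /ball_ /= distrC.
  by move=> x /= xh l; exact: xh.
exists M => //; apply: (le_lt_trans (opnorm_le_entries _)).
apply: (@le_lt_trans _ _ (\sum_(i < m) \sum_(j < k) (h + h))).
  apply: ler_sum => i _; apply: ler_sum => j _.
  apply: (le_trans (normc_le_abs _)); apply: lerD; rewrite !mxE ltW//.
    by have := vw (lshift _ (mxvec_index i j)); rewrite encL; case: (u M i j).
  by have := vw (rshift _ (mxvec_index i j)); rewrite encR; case: (u M i j).
have hh : h + h = e / (m * k).+1%:R.
  by rewrite /h [2 * _]mulrC invfM mulrA -splitr.
rewrite !sumr_const !card_ord -mulrnA mulnC -mulr_natr hh mulrAC.
by rewrite ltr_pdivrMr// ltr_pM2l// ltr_nat.
Qed.

(** Limits in the slack h are taken in this form: bounds that are polynomial in h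
    are first made linear by means of h < 1. *)
Lemma small_slack (x y C : R) : 0 <= C ->
  (forall h, 0 < h -> h < 1 -> x <= y + h * C) -> x <= y.
Proof.
move=> C0 xy; apply/ler_addgt0Pr => e e0.
have s0 : 0 < e + C + 1 by rewrite ltr_wpDl// addr_ge0// ltW.
have h0 : 0 < e / (e + C + 1) by rewrite divr_gt0.
apply: (le_trans (xy _ h0 _)).
  by rewrite ltr_pdivrMr// mul1r; lra.
rewrite lerD2l mulrAC ler_pdivrMr// ler_pM2l//; lra.
Qed.

(** The polyhedron is open, at levels n > 0; and n > 0 here because T is a limit of
    points of the polyhedron. *)
Lemma boundary_opnorm d J (delta : 'M[ncpoly R d]_J) n (T : mtuple R d n) :
  polyhedron_boundary delta T -> 1 <= opnorm (mxeval delta T).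
Proof.
move=> [clT intT]; rewrite leNgt; apply/negP => T1; apply: intT.
have [_ [[n0 _] _]] := clT setT filterT.
have e0 : 0 < 1 - opnorm (mxeval delta T) by rewrite subr_gt0.
suff : nbhs T (polyhedron delta (n := n)) by [].
have near := mxeval_near T delta e0.
apply: (@filterS _ _ (nbhs_filter T) _ _ _ near) => Z TZ.
split; first exact: n0.
apply: (le_lt_trans (opnorm_le_distD (mxeval delta Z) (mxeval delta T))).
by rewrite -ltrBrDl.
Qed.

Lemma liminf_approx (U : topologicalType) (D : set U) (T : U) (f : U -> R)
    (alpha e : R) (V : set U) :
  limf_einf (fun Z => (f Z)%:E) (within D (nbhs T)) = alpha%:E ->
  0 < e -> nbhs T V -> exists Z, [/\ D Z, V Z & f Z < alpha + e].
Proof.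
rewrite limf_einfE => lim e0 TV.
have : (ereal_inf ((fun Z => (f Z)%:E) @` (V `&` D)) < (alpha + e)%:E)%E.
  apply: (@le_lt_trans _ _ alpha%:E); last by rewrite lte_fin ltrDl.
  rewrite -lim; apply: ereal_sup_ubound; exists (V `&` D) => //.
  by rewrite /within /=; apply: filterS TV => Z VZ DZ; split.
by move=> /ereal_inf_lt[_ [Z [VZ DZ] <-]]; rewrite lte_fin => fZ; exists Z.
Qed.

End BoundaryLimit.

(** * Passage to the limit *)

Section JuliaPoint.
Set Implicit Arguments.
Unset Strict Implicit.
Context {R : realType}.

Lemma unitary_defect n (W : 'M[R[i]]_n) :
  defect W W = 0 -> W^t* *m W = 1%:M.
Proof. by move=> /eqP; rewrite subr_eq0 => /eqP. Qed.

Lemma adjB m n (A B : 'M[R[i]]_(m, n)) : (A - B)^t* = A^t* - B^t*.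
Proof. by apply/matrixP => i j; rewrite !mxE rmorphB. Qed.

Lemma defectC n (A B : 'M[R[i]]_n) : (defect A B)^t* = defect B A.
Proof.
by rewrite /defect linearB/= map_mxB trmx1 map_mx1 trmx_mul map_mxM trmxCK.
Qed.

Lemma opnorm_defect_le2 n (A B : 'M[R[i]]_n) :
  opnorm A <= 1 -> opnorm B <= 1 -> opnorm (defect A B) <= 2.
Proof.
move=> A1 B1; apply: (le_trans (opnormD _ _)); rewrite opnormN.
rewrite -[leRHS](natrD _ 1 1) natrD; apply: lerD; first exact: opnorm1_le.
apply: (le_trans (opnormM _ _)); rewrite opnorm_adj.
exact: mulr_ile1 (opnorm_ge0 _) (opnorm_ge0 _) A1 B1.
Qed.

Lemma defectDl n (A A' B : 'M[R[i]]_n) :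
  defect A B = defect A' B + (A' - A)^t* *m B.
Proof. by rewrite /defect adjB mulmxBl addrA subrK. Qed.

#[local] Opaque defect opnorm.

Lemma opnorm_defect_lip n (A A' B : 'M[R[i]]_n) : opnorm B <= 1 ->
  opnorm (defect A B) <= opnorm (defect A' B) + opnorm (A' - A).
Proof.
move=> B1; rewrite (defectDl A A' B); apply: (le_trans (opnormD _ _)).
rewrite lerD2l; apply: (le_trans (opnormM _ _)); rewrite opnorm_adj.
by rewrite ler_piMr ?opnorm_ge0.
Qed.

Lemma opnorm_isometry n (W : 'M[R[i]]_n) : W^t* *m W = 1%:M -> opnorm W <= 1.
Proof.
move=> WW; apply: opnorm_le => // v.
rewrite mul1r -(@ler_pXn2r _ 2) ?nnegrE ?l2norm_ge0//.
by rewrite !sqr_l2norm rdot_adj mulmxA WW mul1mx.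
Qed.

(** An isometry W of C^n is unitary, so W - A = W (1 - W^* A). *)
Lemma dist_isometry_le n (W A : 'M[R[i]]_n) : W^t* *m W = 1%:M ->
  opnorm (A - W) <= opnorm (defect W A).
Proof.
move=> WW; rewrite opnorm_distC.
apply: opnorm_le => [|v]; first exact: opnorm_ge0.
have -> : (W - A) *m v = W *m (defect W A *m v).
  by rewrite mul_defect mulmxBr !mulmxA (mulmx1C WW) mul1mx mulmxBl.
apply: (le_trans (l2norm_mul_le _ _)).
apply: (le_trans (ler_wpM2r (l2norm_ge0 _) (opnorm_isometry WW))).
by rewrite mul1r l2norm_mul_le.
Qed.

(** The numbers stand for x = |defect W (phi Z)|, y = |defect (phi A) (phi Z)| and
    k = |defect (delta A) (delta Z)| at a point A near T with quotient g = r(A), for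
    r = r(Z), and for D = |defect (delta T) (delta Z)|. *)
Lemma julia_slack (alpha r D h g x y k : R) :
  0 <= alpha -> 0 <= r -> 0 <= D -> 0 < h -> h < 1 -> 0 <= y ->
  0 <= x -> 0 <= k -> x <= y + h -> y <= 2 -> k <= D + h -> g <= alpha + h ->
  y ^+ 2 <= g * r * k ^+ 2 ->
  x ^+ 2 <= alpha * r * D ^+ 2
    + h * (r * (D ^+ 2 + (alpha + 1) * (2 * D + 1)) + 5).
Proof.
move=> al0 r0 D0 h0 h1 y0 x0 k0 xy y2 kD ga yk.
have hh : h ^+ 2 <= h by rewrite expr2 ger_pMl// ltW.
have x2 : x ^+ 2 <= y ^+ 2 + 5 * h.
  have : x ^+ 2 <= (y + h) ^+ 2 by rewrite ler_pXn2r ?nnegrE ?addr_ge0// ltW.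
  have : 0 <= h * (2 - y) by rewrite mulr_ge0 ?subr_ge0// ltW.
  rewrite sqrrD mulr2n; lra.
have k2 : k ^+ 2 <= D ^+ 2 + h * (2 * D + 1).
  have : k ^+ 2 <= (D + h) ^+ 2 by rewrite ler_pXn2r ?nnegrE ?addr_ge0// ltW.
  rewrite sqrrD mulr2n; lra.
have kD0 : 0 <= D ^+ 2 + h * (2 * D + 1) by exact: le_trans (sqr_ge0 k) k2.
have step : g * r * k ^+ 2 <= (alpha + h) * r * (D ^+ 2 + h * (2 * D + 1)).
  apply: (@le_trans _ _ ((alpha + h) * r * k ^+ 2)).
    by rewrite ler_wpM2r ?sqr_ge0// ler_wpM2r.
  by rewrite ler_wpM2l// mulr_ge0// addr_ge0// ltW.
have : 0 <= r * h * (1 - h) * (2 * D + 1).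
  have D1 : 0 <= 2 * D + 1 by rewrite addr_ge0// mulr_ge0.
  have rh : 0 <= r * h by rewrite mulr_ge0// ltW.
  have hc : 0 <= 1 - h by rewrite subr_ge0 ltW.
  exact: mulr_ge0 (mulr_ge0 rh hc) D1.
lra.
Qed.

(** The numbers stand for g = r(A) and t = |delta A| at a point A near T, for
    a = |defect W W|, b = |defect (phi A) W| and e = |phi A - W|; the norm of
    defect (phi A) (phi A) is g (1 - t^2), small because t is close to 1. *)
Lemma unitary_slack (alpha g t h a b e : R) :
  0 <= g -> g <= alpha + h -> 0 < h -> h < 1 -> 1 <= t + h -> 0 <= t -> t < 1 ->
  a <= b + e -> b <= g * (1 - t ^+ 2) + e -> e <= h ->
  a <= h * (2 * (alpha + 1) + 2).
Proof.
move=> g0 ga h0 h1 th t0 t1 abe bge eh.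
have t2 : 1 - t ^+ 2 <= 2 * h.
  have : 0 <= (t + h - 1) * (1 + t).
    by apply: mulr_ge0; [rewrite subr_ge0 | exact: addr_ge0].
  have : 0 <= h * (1 - t) by rewrite mulr_ge0 ?subr_ge0 ?(ltW h0) ?(ltW t1).
  lra.
have : g * (1 - t ^+ 2) <= g * (2 * h) by rewrite ler_wpM2l.
have : 0 <= h * (alpha + h - g) by rewrite mulr_ge0 ?subr_ge0 ?(ltW h0).
have : 0 <= h * (1 - h) by rewrite mulr_ge0 ?subr_ge0 ?(ltW h0) ?(ltW h1).
lra.
Qed.

End JuliaPoint.

Theorem theorem3p6 (R : realType) (d J : nat) (delta : 'M[ncpoly R d]_J)
    (phi : graded_fun R d) (n : nat) (T : mtuple R d n) (alpha : R) :
  schur_class delta phi ->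
  polyhedron_boundary delta T ->
  limf_einf
    (fun Z : mtuple R d n =>
       (opnorm (1%:M - (phi n Z)^t* *m phi n Z)
          / (1 - opnorm (mxeval delta Z) ^+ 2))%:E)
    (within (polyhedron delta (n := n)) (nbhs T)) = alpha%:E ->
  exists W : 'M[R[i]]_n, W \is unitarymx /\
    forall Z : mtuple R d n, polyhedron delta Z ->
      opnorm (phi n Z - W) ^+ 2 / opnorm (1%:M - (phi n Z)^t* *m phi n Z)
      <= alpha *
         (opnorm (1%:M - (mxeval delta T)^t* *m mxeval delta Z) ^+ 2
            / (1 - opnorm (mxeval delta Z) ^+ 2)).
Proof.
move=> S bT lim.
have T1 := boundary_opnorm bT.
(* For J = 0 the value of delta at T would be an empty matrix, of norm 0. *)
have J0 : (0 < J)%N.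
  rewrite lt0n; apply/eqP => J0; move: T1; rewrite leNgt => /negP; apply.
  apply: le_lt_trans ltr01; apply: opnorm_le => // v.
  have -> : mxeval delta T *m v = 0.
    by apply/matrixP => -[i iJ] j; exfalso; rewrite J0 in iJ.
  by rewrite l2norm0 mul0r.
pose ratio Z := opnorm (defect (phi n Z) (phi n Z))
          / (1 - opnorm (mxeval delta Z) ^+ 2).
have approx h : 0 < h -> exists Z, [/\ polyhedron delta Z,
    opnorm (mxeval delta Z - mxeval delta T) < h & ratio Z < alpha + h].
  move=> h0.
  exact: (liminf_approx lim h0 (mxeval_near T delta h0)).
have /choice[Y Yn] : forall N : nat, exists Z, [/\ polyhedron delta Z,
    opnorm (mxeval delta Z - mxeval delta T) < N.+1%:R^-1
    & ratio Z < alpha + N.+1%:R^-1].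
  by move=> N; apply: approx; rewrite invr_gt0.
have phi1 Z : polyhedron delta Z -> opnorm (phi n Z) < 1 by exact: S.2.
have [W limW] : exists W, forall e N, 0 < e ->
    exists2 M, (N <= M)%N & opnorm (phi n (Y M) - W) < e.
  by apply: unit_ball_cluster => N; apply: ltW; apply: phi1; case: (Yn N).
have {limW Yn}approx h : 0 < h -> exists Z, [/\ polyhedron delta Z,
    opnorm (mxeval delta Z - mxeval delta T) < h, ratio Z < alpha + h
    & opnorm (phi n Z - W) < h].
  move=> h0; have [N Nh] : exists N, N.+1%:R^-1 < h.
    have hV0 : 0 <= h^-1 by rewrite invr_ge0 ltW.
    exists (Num.bound h^-1); rewrite -[ltRHS]invrK ltf_pV2 ?posrE ?invr_gt0//.
    by apply: (lt_le_trans (archi_boundP hV0)); rewrite ler_nat.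
  have [M NM MW] := limW h N h0; exists (Y M); have [PY TY rY] := Yn M.
  have Mh : M.+1%:R^-1 < h.
    by apply: le_lt_trans Nh; rewrite lef_pV2 ?posrE// ler_nat.
  split=> //; first exact: lt_trans Mh.
  by apply: (lt_trans rY); rewrite ltrD2l.
have ratio0 Z : polyhedron delta Z -> 0 <= ratio Z.
  by case=> _ Z1; rewrite divr_ge0 ?opnorm_ge0// ltW// opnorm_sqr_lt1.
have al0 : 0 <= alpha.
  apply/ler_addgt0Pr => h h0; have [Z [/ratio0 Z0 _ Zh _]] := approx _ h0.
  exact: le_trans Z0 (ltW Zh).
have phiZ Z : polyhedron delta Z -> opnorm (phi n Z) <= 1.
  by move=> /phi1 /ltW.
have W1 : opnorm W <= 1.
  apply: (small_slack ler01) => h h0 h1; rewrite mulr1.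
  have [A [PA _ _ AW]] := approx _ h0.
  apply: (le_trans (opnorm_le_distD W (phi n A))); rewrite opnorm_distC.
  by apply: lerD; [exact: phiZ | exact: ltW].
have WW : W^t* *m W = 1%:M.
  apply: unitary_defect; apply: opnorm_eq0.
  have C0 : 0 <= 2 * (alpha + 1) + 2 by rewrite addr_ge0// mulr_ge0// addr_ge0.
  apply: (small_slack C0) => h h0 h1; rewrite add0r.
  have [A [PA TA rA AW]] := approx _ h0; have [_ A1] := PA.
  have step1 := opnorm_defect_lip W (phi n A) W1.
  have step2 : opnorm (defect (phi n A) W) <=
      opnorm (defect (phi n A) (phi n A)) + opnorm (phi n A - W).
    rewrite -(opnorm_adj (defect (phi n A) W)) defectC.
    exact: opnorm_defect_lip (phiZ _ PA).
  have rE : opnorm (defect (phi n A) (phi n A)) =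
      ratio A * (1 - opnorm (mxeval delta A) ^+ 2).
    by rewrite /ratio divfK// gt_eqF// opnorm_sqr_lt1.
  have tA : 1 <= opnorm (mxeval delta A) + h.
    apply: (le_trans T1).
    apply: (le_trans (opnorm_le_distD _ (mxeval delta A))).
    by rewrite lerD2l opnorm_distC ltW.
  rewrite rE in step2.
  exact: (unitary_slack (ratio0 _ PA) (ltW rA) h0 h1 tA (opnorm_ge0 _) A1
    step1 step2 (ltW AW)).
exists W; split; first by apply/unitarymxP; exact: mulmx1C.
move=> Z PZ; have [n0 Z1] := PZ.
have main : opnorm (defect W (phi n Z)) ^+ 2 <= alpha * ratio Z *
    opnorm (defect (mxeval delta T) (mxeval delta Z)) ^+ 2.
  have rZ := ratio0 _ PZ.
  have D0 := opnorm_ge0 (defect (mxeval delta T) (mxeval delta Z)).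
  set D := opnorm _ in D0 *.
  have C0 : 0 <= ratio Z * (D ^+ 2 + (alpha + 1) * (2 * D + 1)) + 5.
    rewrite addr_ge0// mulr_ge0// addr_ge0 ?sqr_ge0// mulr_ge0// addr_ge0//.
    by rewrite mulr_ge0.
  apply: (small_slack C0) => h h0 h1.
  have [A [PA TA rA AW]] := approx _ h0.
  apply: (julia_slack al0 rZ D0 h0 h1 (opnorm_ge0 (defect (phi n A) (phi n Z)))
    (opnorm_ge0 _) (opnorm_ge0 (defect (mxeval delta A) (mxeval delta Z)))
    _ _ _ (ltW rA)).
  - apply: (le_trans (opnorm_defect_lip W (phi n A) (phiZ _ PZ))).
    by rewrite lerD2l ltW.
  - by apply: opnorm_defect_le2; exact: phiZ.
  - apply: (le_trans (opnorm_defect_lip _ (mxeval delta T) (ltW Z1))).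
    by rewrite lerD2l opnorm_distC ltW.
  - exact: schur_two_point.
have c0 : 0 < opnorm (defect (phi n Z) (phi n Z)).
  exact: opnorm_defect_gt0 n0 (phi1 _ PZ) (phi1 _ PZ).
have dist : opnorm (phi n Z - W) ^+ 2 <= opnorm (defect W (phi n Z)) ^+ 2.
  apply: (lerXn2r 2 (opnorm_ge0 _) (opnorm_ge0 _)).
  exact: dist_isometry_le WW.
have regroup (a c f D : R) : a * (c / f) * D = a * (D / f) * c.
  by rewrite -!mulrA; congr (_ * _); rewrite mulrCA [RHS]mulrCA; congr (_ * _);
    exact: mulrC.
have : opnorm (phi n Z - W) ^+ 2 / opnorm (defect (phi n Z) (phi n Z)) <=
    alpha * (opnorm (defect (mxeval delta T) (mxeval delta Z)) ^+ 2
            / (1 - opnorm (mxeval delta Z) ^+ 2)).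
  by rewrite (ler_pdivrMr _ _ c0) -regroup; exact: le_trans dist main.
exact.
Qed.
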